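(* Let $R$ be a commutative ring with $1$ and let $\tau$ be a symmetric relation on $R^{\#}$. Let $a=\lambda a_1\cdots a_n$ be a $\tau$-factorization of a nonunit $a$, and consider the statements: (1) this is a $\tau$-very strongly atomic factorization; (2) this is a $\tau$-unrefinably atomic factorization; (3) this is a $\tau$-complete factorization; (4) this is a $\tau$-strongly atomic factorization; (5) this is a $\tau$-m-atomic factorization; (6) this is a $\tau$-atomic factorization. Then the following implications hold: (1) $\Rightarrow$ (2); (2) $\Rightarrow$ (3); (2) $\Rightarrow$ (4); (2) $\Rightarrow$ (5); (4) $\Rightarrow$ (6); (5) $\Rightarrow$ (6); if $\tau$ is refinable, then (3) $\Rightarrow$ (2), (3) $\Rightarrow$ (4) and (3) $\Rightarrow$ (5); if $R$ is strongly associate, then (5) $\Rightarrow$ (4).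
   Context: $U(R)$ is the set of units of $R$ and $R^{\#}$ the set of nonzero nonunits. For $a,b\in R$: $a\sim b$ if $(a)=(b)$; $a\approx b$ if $a=\lambda b$ for some $\lambda\in U(R)$; $a\cong b$ if $a\sim b$ and either $a=b=0$, or $a=rb$ with $r\in R$ implies $r\in U(R)$. $R$ is strongly associate if $a\sim b$ implies $a\approx b$ for all $a,b\in R$. A $\tau$-factorization of a nonunit $a$ is an expression $a=\lambda a_1\cdots a_n$ with $n\ge 1$, $\lambda\in U(R)$, the $a_i$ nonunits, and $a_i\,\tau\,a_j$ for all $i\ne j$; $n$ is its length, and it is trivial if $n=1$. A $\tau$-refinement of a $\tau$-factorization $\lambda a_1\cdots a_n$ is a $\tau$-factorization of the form $(\lambda\lambda_1\cdots\lambda_n)b_{11}\cdots b_{1m_1}\cdots b_{n1}\cdots b_{nm_n}$ where $a_i=\lambda_i b_{i1}\cdots b_{im_i}$ is a $\tau$-factorization for each $i$. The relation $\tau$ is refinable if, for every $\tau$-factorization $\lambda a_1\cdots a_n$ and all $\tau$-factorizations $a_i=\lambda_i b_{i1}\cdots b_{im_i}$, the resulting product is a $\tau$-factorization. A nonunit $a$ is: $\tau$-atomic ($\tau$-irreducible) if for every $\tau$-factorization $a=\lambda a_1\cdots a_n$, $a\sim a_i$ for some $i$; $\tau$-strongly atomic if for every such factorization $a\approx a_i$ for some $i$; $\tau$-m-atomic if for every such factorization $a\sim a_i$ for all $i$; $\tau$-unrefinably atomic if $a$ has no non-trivial $\tau$-factorizations; $\tau$-very strongly atomic if $a\cong a$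 and $a$ has no non-trivial $\tau$-factorizations. A $\tau$-atomic (resp. $\tau$-strongly atomic, $\tau$-m-atomic, $\tau$-unrefinably atomic, $\tau$-very strongly atomic) factorization is a $\tau$-factorization each of whose factors $a_i$ has that property. A $\tau$-complete factorization is a $\tau$-factorization having no $\tau$-refinement of strictly larger length. *)

(* Defs.v *)
From mathcomp Require Import all_boot all_algebra.
Set Implicit Arguments.
Unset Strict Implicit.
Unset Printing Implicit Defensive.
Import GRing.Theory.
Local Open Scope ring_scope.

(* [GRing.unit] is only available on [unitRingType], which rules out the zero *)
(* ring; units are therefore defined on arbitrary commutative rings.          *)
Definition is_unit (R : comPzRingType) (u : R) : Prop := exists v : R, v * u = 1.

Definition nonunit (R : comPzRingType) (a : R) : Prop := ~ is_unit a.

Definition nonzero_nonunit (R : comPzRingType) (a : R) : Prop :=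
  a <> 0 /\ nonunit a.

Definition principal_ideal (R : comPzRingType) (a : R) : R -> Prop :=
  fun x => exists r : R, x = r * a.

Definition assoc (R : comPzRingType) (a b : R) : Prop :=
  forall x : R, principal_ideal a x <-> principal_ideal b x.

Definition strong_assoc (R : comPzRingType) (a b : R) : Prop :=
  exists2 u : R, is_unit u & a = u * b.

Definition very_strong_assoc (R : comPzRingType) (a b : R) : Prop :=
  assoc a b /\ ((a = 0 /\ b = 0) \/ (forall r : R, a = r * b -> is_unit r)).

Definition strongly_associate_ring (R : comPzRingType) : Prop :=
  forall a b : R, assoc a b -> strong_assoc a b.

(* A relation on the subset [R^#] is a relation on [R] relating only elements *)
(* of [R^#].                                                                  *)
Definition symmetric_relation_on_nonzero_nonunits
    (R : comPzRingType) (tau : R -> R -> Prop) : Prop :=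
  (forall a b : R, tau a b -> nonzero_nonunit a /\ nonzero_nonunit b) /\
  (forall a b : R, tau a b -> tau b a).

(* The formal expression [lambda a_1 ... a_n], encoded as                     *)
(* [(lambda, [:: a_1; ...; a_n])].                                            *)
Definition expression (R : comPzRingType) : Type := (R * seq R)%type.

Definition length (R : comPzRingType) (f : expression R) : nat := size f.2.

Record tau_factorization (R : comPzRingType) (tau : R -> R -> Prop)
    (a : R) (f : expression R) : Prop := TauFactorization {
  tau_factorization_nonunit : nonunit a;
  tau_factorization_length : (0 < length f)%N;
  tau_factorization_unit : is_unit f.1;
  tau_factorization_factors : forall x : R, x \in f.2 -> nonunit x;
  tau_factorization_rel : forall i j : nat,
    (i < length f)%N -> (j < length f)%N -> i <> j -> tau f.2`_i f.2`_j;
  tau_factorization_eq : a = f.1 * \prod_(x <- f.2) x }.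

(* [gs] lists, for each factor [a_i] of [f], a tau-factorization              *)
(* [lambda_i b_i1 ... b_im_i] of [a_i].                                       *)
Definition factorwise_factorizations (R : comPzRingType)
    (tau : R -> R -> Prop) (f : expression R) (gs : seq (expression R)) : Prop :=
  size gs = length f /\
  (forall i : nat, (i < length f)%N ->
     tau_factorization tau f.2`_i (nth (1, [::]) gs i)).

(* [(lambda lambda_1 ... lambda_n) b_11 ... b_1m_1 ... b_n1 ... b_nm_n]       *)
Definition substitute (R : comPzRingType)
    (f : expression R) (gs : seq (expression R)) : expression R :=
  (f.1 * \prod_(g <- gs) g.1, flatten [seq g.2 | g <- gs]).

Definition tau_refinement (R : comPzRingType) (tau : R -> R -> Prop)
    (a : R) (f h : expression R) : Prop :=
  tau_factorization tau a h /\
  exists2 gs : seq (expression R),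
    factorwise_factorizations tau f gs & h = substitute f gs.

Definition refinable (R : comPzRingType) (tau : R -> R -> Prop) : Prop :=
  forall (a : R) (f : expression R) (gs : seq (expression R)),
    tau_factorization tau a f -> factorwise_factorizations tau f gs ->
    tau_factorization tau a (substitute f gs).

Definition has_nontrivial_tau_factorization (R : comPzRingType)
    (tau : R -> R -> Prop) (a : R) : Prop :=
  exists2 f : expression R, tau_factorization tau a f & length f <> 1%N.

Definition tau_atomic (R : comPzRingType) (tau : R -> R -> Prop) (a : R) : Prop :=
  nonunit a /\
  forall f : expression R, tau_factorization tau a f ->
    exists2 x : R, x \in f.2 & assoc a x.

Definition tau_strongly_atomic (R : comPzRingType) (tau : R -> R -> Prop)
    (a : R) : Prop :=
  nonunit a /\
  forall f : expression R, tau_factorization tau a f ->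
    exists2 x : R, x \in f.2 & strong_assoc a x.

Definition tau_m_atomic (R : comPzRingType) (tau : R -> R -> Prop) (a : R) : Prop :=
  nonunit a /\
  forall f : expression R, tau_factorization tau a f ->
    forall x : R, x \in f.2 -> assoc a x.

Definition tau_unrefinably_atomic (R : comPzRingType) (tau : R -> R -> Prop)
    (a : R) : Prop :=
  nonunit a /\ ~ has_nontrivial_tau_factorization tau a.

Definition tau_very_strongly_atomic (R : comPzRingType) (tau : R -> R -> Prop)
    (a : R) : Prop :=
  [/\ nonunit a, very_strong_assoc a a
    & ~ has_nontrivial_tau_factorization tau a].

Definition factorization_into (R : comPzRingType) (tau : R -> R -> Prop)
    (P : R -> Prop) (a : R) (f : expression R) : Prop :=
  tau_factorization tau a f /\ (forall x : R, x \in f.2 -> P x).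

Definition tau_very_strongly_atomic_factorization (R : comPzRingType)
    (tau : R -> R -> Prop) (a : R) (f : expression R) : Prop :=
  factorization_into tau (tau_very_strongly_atomic tau) a f.

Definition tau_unrefinably_atomic_factorization (R : comPzRingType)
    (tau : R -> R -> Prop) (a : R) (f : expression R) : Prop :=
  factorization_into tau (tau_unrefinably_atomic tau) a f.

Definition tau_strongly_atomic_factorization (R : comPzRingType)
    (tau : R -> R -> Prop) (a : R) (f : expression R) : Prop :=
  factorization_into tau (tau_strongly_atomic tau) a f.

Definition tau_m_atomic_factorization (R : comPzRingType)
    (tau : R -> R -> Prop) (a : R) (f : expression R) : Prop :=
  factorization_into tau (tau_m_atomic tau) a f.

Definition tau_atomic_factorization (R : comPzRingType)
    (tau : R -> R -> Prop) (a : R) (f : expression R) : Prop :=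
  factorization_into tau (tau_atomic tau) a f.

Definition tau_complete_factorization (R : comPzRingType)
    (tau : R -> R -> Prop) (a : R) (f : expression R) : Prop :=
  tau_factorization tau a f /\
  ~ (exists2 h : expression R,
       tau_refinement tau a f h & (length f < length h)%N).

(* Main.v *)
Require Import Defs.
From mathcomp Require Import all_boot all_algebra.

Import GRing.Theory.
Local Open Scope ring_scope.

(** If a factor has no non-trivial [tau]-factorization, its only factorizations have the form
    [l * y] with [l] a unit, so it is strongly associate to the one factor [y]
    ([unrefinably_atomic_strong_assoc]). Strong and m-atomicity follow factor by factor, and
    [factorization_into_impl] lifts such implications to factorizations. Completeness is a matter of
    counting: a refinement has as many factors as the substituted factorizations together. If all of
    these have length one, nothing grows; conversely, a non-trivial factorization of one factor,
    with the others kept, gives a strictly longer product, which is a [tau]-factorization when [tau]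
    is refinable. *)

Section TauFactorizations.

Variables (R : comPzRingType) (tau : R -> R -> Prop).
Implicit Types (a b x : R) (f g : expression R).

Lemma strong_assoc_assoc a b : strong_assoc a b -> assoc a b.
Proof.
case=> u [v vu1] -> x; split=> -[r ->].
  by exists (r * u); rewrite mulrA.
by exists (r * v); rewrite -mulrA (mulrA v) vu1 mul1r.
Qed.

(** One factor leaves no pair of distinct indices, so the [tau] condition is vacuous. This keeps a
    factor unchanged inside a refinement. *)
Lemma trivial_tau_factorization a :
  nonunit a -> tau_factorization tau a (1, [:: a]).
Proof.
move=> aN; split=> //=; first by exists 1; rewrite mulr1.
- by move=> x; rewrite inE => /eqP ->.
- by move=> [|i] [|j].
- by rewrite big_seq1 mul1r.
Qed.

(** Supplies the witness when a property of all factors is weakened to one of some factor. *)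
Lemma tau_factorization_head a f :
  tau_factorization tau a f -> exists x, x \in f.2.
Proof. by case: f => l [|x s] [] //= *; exists x; rewrite mem_head. Qed.

Lemma length_tau_factorization_unrefinably_atomic a f :
  tau_unrefinably_atomic tau a -> tau_factorization tau a f -> length f = 1%N.
Proof.
(* Equality of lengths is decidable, so arguing by contradiction needs no classical axiom. *)
by case=> _ a_irr af; apply/eqP; apply: contra_notT a_irr => /eqP; exists f.
Qed.

Lemma unrefinably_atomic_strong_assoc a f x :
    tau_unrefinably_atomic tau a -> tau_factorization tau a f -> x \in f.2 ->
  strong_assoc a x.
Proof.
move=> a_irr af; have := length_tau_factorization_unrefinably_atomic a f a_irr af.
case: f af => l [|y [|z s]] //= [_ _ lU _ _ ->] _.
by rewrite inE => /eqP ->; exists l; rewrite ?big_seq1.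
Qed.

Lemma very_strongly_atomic_unrefinably_atomic a :
  tau_very_strongly_atomic tau a -> tau_unrefinably_atomic tau a.
Proof. by case. Qed.

Lemma unrefinably_atomic_strongly_atomic a :
  tau_unrefinably_atomic tau a -> tau_strongly_atomic tau a.
Proof.
move=> a_irr; split=> [|f af]; first by case: a_irr.
have [x xf] := tau_factorization_head a f af.
by exists x => //; apply: unrefinably_atomic_strong_assoc af xf.
Qed.

Lemma unrefinably_atomic_m_atomic a :
  tau_unrefinably_atomic tau a -> tau_m_atomic tau a.
Proof.
move=> a_irr; split=> [|f af x xf]; first by case: a_irr.
by apply: strong_assoc_assoc; apply: unrefinably_atomic_strong_assoc af xf.
Qed.

Lemma strongly_atomic_atomic a : tau_strongly_atomic tau a -> tau_atomic tau a.
Proof.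
case=> aN a_at; split=> // f /a_at[x xf ax].
by exists x => //; apply: strong_assoc_assoc.
Qed.

Lemma m_atomic_atomic a : tau_m_atomic tau a -> tau_atomic tau a.
Proof.
case=> aN a_at; split=> // f af; have [x xf] := tau_factorization_head a f af.
by exists x => //; apply: a_at af x xf.
Qed.

Lemma m_atomic_strongly_atomic a :
  strongly_associate_ring R -> tau_m_atomic tau a -> tau_strongly_atomic tau a.
Proof.
move=> R_sa [aN a_at]; split=> // f af.
have [x xf] := tau_factorization_head a f af.
by exists x => //; apply/R_sa; apply: a_at af x xf.
Qed.

Lemma factorization_into_impl (P Q : R -> Prop) a f :
    (forall x, P x -> Q x) ->
  factorization_into tau P a f -> factorization_into tau Q a f.
Proof. by move=> PQ [af fP]; split=> // x /fP/PQ. Qed.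

Lemma length_substitute f (gs : seq (expression R)) :
  length (substitute f gs) = (\sum_(g <- gs) length g)%N.
Proof. by rewrite /length size_flatten /shape -map_comp sumnE big_map. Qed.

Lemma unrefinably_atomic_complete_factorization a f :
    tau_unrefinably_atomic_factorization tau a f ->
  tau_complete_factorization tau a f.
Proof.
case=> af f_irr; split=> // -[h [_ [gs [sz_gs gsP] ->]]].
rewrite length_substitute -sz_gs -sum1_size.
(* Both lengths become the same sum of ones once each [g] in [gs] is shown to have length one;
   [index g gs] locates a factor of [f] that [g] factors. *)
rewrite [X in (_ < X)%N](eq_big_seq (fun=> 1%N)) ?ltnn // => g g_gs.
have lt_g : (index g gs < length f)%N by rewrite -sz_gs index_mem.
have := gsP _ lt_g; rewrite nth_index //.
by apply: length_tau_factorization_unrefinably_atomic; apply/f_irr/mem_nth.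
Qed.

Lemma complete_unrefinably_atomic_factorization a f :
    refinable tau -> tau_complete_factorization tau a f ->
  tau_unrefinably_atomic_factorization tau a f.
Proof.
move=> tau_ref [af f_complete]; split=> // x xf.
split=> [|[g xg g_neq1]]; first exact: tau_factorization_factors af x xf.
apply: f_complete.
pose i := index x f.2; have lt_i : (i < length f)%N by rewrite /length index_mem.
(* Refining only the offending factor already increases the length. *)
pose G j : expression R := if j == i then g else (1, [:: f.2`_j]).
have fG : factorwise_factorizations tau f (mkseq G (length f)).
  split=> [|j lt_j]; first exact: size_mkseq.
  rewrite nth_mkseq // /G; case: eqP => [->|_]; first by rewrite nth_index.
  by apply/trivial_tau_factorization/(tau_factorization_factors af)/mem_nth.
exists (substitute f (mkseq G (length f))).
  by split; [apply: tau_ref | exists (mkseq G (length f))].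
(* Recasting the [iota] of [mkseq] as [index_iota] turns the total length into a sum over ordinals,
   from which the term at [i] can be split off. *)
rewrite length_substitute big_map -{2}[length f]subn0 -/(index_iota 0 _).
rewrite big_mkord (bigD1 (Ordinal lt_i)) //= {1}/G eqxx.
have -> : (\sum_(j < length f | j != Ordinal lt_i) length (G j)
           = (length f).-1)%N.
  rewrite (eq_bigr (fun=> 1%N)) => [|j /negPf]; last first.
    by rewrite -val_eqE /G /= => ->.
  by rewrite sum1_card cardC1 card_ord.
(* Length zero is excluded by definition, so non-trivial means at least two factors. *)
have lt1g : (1 < length g)%N.
  by rewrite ltn_neqAle eq_sym (introN eqP g_neq1) (tau_factorization_length xg).
rewrite -[ltnLHS](prednK (leq_ltn_trans (leq0n i) lt_i)).
exact: leq_add lt1g (leqnn _).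
Qed.

End TauFactorizations.

Theorem theorem3p1 (R : comPzRingType) (tau : R -> R -> Prop)
    (htau : symmetric_relation_on_nonzero_nonunits tau)
    (a : R) (f : expression R) (hf : tau_factorization tau a f) :
  (tau_very_strongly_atomic_factorization tau a f ->
     tau_unrefinably_atomic_factorization tau a f) /\
  (tau_unrefinably_atomic_factorization tau a f ->
     tau_complete_factorization tau a f) /\
  (tau_unrefinably_atomic_factorization tau a f ->
     tau_strongly_atomic_factorization tau a f) /\
  (tau_unrefinably_atomic_factorization tau a f ->
     tau_m_atomic_factorization tau a f) /\
  (tau_strongly_atomic_factorization tau a f ->
     tau_atomic_factorization tau a f) /\
  (tau_m_atomic_factorization tau a f ->
     tau_atomic_factorization tau a f) /\
  (refinable tau ->
     (tau_complete_factorization tau a f ->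
        tau_unrefinably_atomic_factorization tau a f) /\
     (tau_complete_factorization tau a f ->
        tau_strongly_atomic_factorization tau a f) /\
     (tau_complete_factorization tau a f ->
        tau_m_atomic_factorization tau a f)) /\
  (strongly_associate_ring R ->
     tau_m_atomic_factorization tau a f ->
     tau_strongly_atomic_factorization tau a f).
Proof.
have U_S := unrefinably_atomic_strongly_atomic R tau.
have U_M := unrefinably_atomic_m_atomic R tau.
have C_U : refinable tau -> _ :=
  complete_unrefinably_atomic_factorization R tau a f.
split; first exact/factorization_into_impl/very_strongly_atomic_unrefinably_atomic.
split; first exact: unrefinably_atomic_complete_factorization.
split; first exact: factorization_into_impl.
split; first exact: factorization_into_impl.
split; first exact/factorization_into_impl/strongly_atomic_atomic.
split; first exact/factorization_into_impl/m_atomic_atomic.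
split=> [tau_ref | R_sa]; last first.
  by apply: factorization_into_impl => x; apply: m_atomic_strongly_atomic.
split; first exact: C_U.
(* Both remaining implications pass through unrefinable atomicity. *)
by split=> /(C_U tau_ref); apply: factorization_into_impl.
Qed.
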